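(* For all integers $n\ge2$, $W_n=\frac12$.
   Context: For $n\ge2$, $\widehat{\mathcal M}_{n-1}$ is the set of measurable non-negative (real-valued) functions on $[0,1]^{n-1}$ (''imaginary strategies''). For real $x$, $\varepsilon(x):=\lfloor x\rfloor-2\lfloor x/2\rfloor\in\{0,1\}$. For $x=(x_1,\dots,x_n)$, $x_{-i}:=(x_1,\dots,x_{i-1},x_{i+1},\dots,x_n)$. $\Lambda^n$ is Lebesgue measure on $\mathbb R^n$. Define $$W_n:=\sup_{f_1,\dots,f_n\in\widehat{\mathcal M}_{n-1}}\int_{[0,1]^n}\prod_{i=1}^n\varepsilon\bigl(f_i(x_{-i})x_i\bigr)\,\mathrm d\Lambda^n.$$ *)

(* Defs.v *)
From HB Require Import structures.
From mathcomp Require Import all_boot all_order all_algebra.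
From mathcomp Require Import all_classical all_reals all_analysis.

Set Implicit Arguments.
Unset Strict Implicit.
Unset Printing Implicit Defensive.

Import Order.TTheory GRing.Theory Num.Theory.
Import numFieldNormedType.Exports.

Local Open Scope classical_set_scope.
Local Open Scope ring_scope.

Section lebesgue_tuple.
Context {R : realType}.
Local Notation T := (measurableTypeR R).

Definition cons_pair n (p : T * n.-tuple T) : n.+1.-tuple T :=
  [tuple of p.1 :: p.2].

(* Points of R^n are n-tuples, with the product sigma-algebra (i.e. the Borel
   sets). The unique point of R^0 has mass 1, and Lebesgue measure on R^(m+1)
   is the product of those on R and R^m, transported along
   (x, t) |-> x :: t. *)
Fixpoint lebesgue_tuple (n : nat) : set (n.-tuple T) -> \bar R :=
  match n return set (n.-tuple T) -> \bar R with
  | 0%N => @dirac _ (0.-tuple T) [tuple] R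
  | m.+1 => pushforward (lebesgue_measure \x lebesgue_tuple (n := m))%E
                        (@cons_pair m)
  end.
Arguments lebesgue_tuple n A : clear implicits.

Lemma measurable_cons_pair n : measurable_fun setT (@cons_pair n).
Proof. exact: measurable_cons. Qed.

Definition box n (A : 'I_n -> set T) : set (n.-tuple T) :=
  [set x | forall i, A i (tnth x i)].

Lemma measurable_box n (A : 'I_n -> set T) :
  (forall i, measurable (A i)) -> measurable (box A).
Proof.
move=> mA.
rewrite (_ : box A = \bigcap_(i in [set: 'I_n]) (@tnth _ T ^~ i) @^-1` A i).
  apply: fin_bigcap_measurable => // i _.
  by rewrite -[X in measurable X]setTI; exact: measurable_tnth.
by apply/seteqP; split => x /= Ax i => [_|]; exact: Ax.
Qed.

Lemma cons_pair_box n (A : 'I_n.+1 -> set T) :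
  @cons_pair n @^-1` box A = A ord0 `*` box (fun i => A (lift ord0 i)).
Proof.
apply/seteqP; split => [[x t] /= Ax|[x t] [/= Ax At] i].
  split=> /=; first exact: (Ax ord0).
  by move=> i; move: (Ax (lift ord0 i)); rewrite /cons_pair tnthS.
by case: (unliftP ord0 i) => [j ->|->]; rewrite /cons_pair ?tnthS//; exact: At.
Qed.

Let symbox n (k : nat) : set (n.-tuple T) :=
  box (fun=> `[- k%:R, k%:R]%classic).

Let symbox_cover n : setT = \bigcup_k @symbox n k.
Proof.
apply/esym; rewrite -subTset => x _.
pose M := \sum_(i < n) `|tnth x i|.
have M0 : 0 <= M by exact: sumr_ge0.
exists (Num.truncn M).+1 => // i /=.
change (tnth x i \in `[- (Num.truncn M).+1%:R, (Num.truncn M).+1%:R]).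
rewrite in_itv/= -ler_norml.
apply: (@le_trans _ _ M); last exact/ltW/truncnS_gt.
by rewrite /M (bigD1 i)//= lerDl sumr_ge0.
Qed.

Section step.
Variables (n : nat) (mu : {sigma_finite_measure set (n.-tuple T) -> \bar R}).

Let nu : set (n.+1.-tuple T) -> \bar R :=
  pushforward (lebesgue_measure \x mu)%E (@cons_pair n).

Let nu0 : (nu set0 = 0)%E.
Proof. by rewrite /nu /pushforward preimage_set0 measure0. Qed.

Let nu_ge0 A : (0 <= nu A)%E.
Proof. by rewrite /nu /pushforward; exact: measure_ge0. Qed.

Let nu_additive : semi_sigma_additive nu.
Proof.
by apply: measure_semi_sigma_additive; exact: measurable_cons_pair.
Qed.

#[local] HB.instance Definition _ := isMeasure.Build _ _ _ nu nu0 nu_ge0 nu_additive.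

Let nu_box (A : 'I_n.+1 -> set T) : (forall i, measurable (A i)) ->
  (nu (box A) = lebesgue_measure (A ord0) * mu (box (fun i => A (lift ord0 i))))%E.
Proof.
move=> mA; rewrite /nu /pushforward cons_pair_box product_measure1E//.
exact: measurable_box.
Qed.

Hypothesis mu_box : forall A : 'I_n -> set T, (forall i, measurable (A i)) ->
  (mu (box A) = \prod_(i < n) lebesgue_measure (A i))%E.

Let nu_sigma_finite : sigma_finite setT nu.
Proof.
exists (@symbox n.+1); first exact: symbox_cover.
move=> k; split; first exact: measurable_box.
rewrite nu_box// mu_box//.
have mk : lebesgue_measure (`[- k%:R, k%:R]%classic : set T) \is a fin_num.
  by rewrite lebesgue_measure_itv/=; case: ifP.
by rewrite lte_mul_pinfty// ltey_eq prode_fin_num.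
Qed.

#[local] HB.instance Definition _ :=
  Measure_isSigmaFinite.Build _ _ _ nu nu_sigma_finite.

Lemma lebesgue_tuple_step :
  exists nu' : {sigma_finite_measure set (n.+1.-tuple T) -> \bar R},
    nu' = pushforward (lebesgue_measure \x mu)%E (@cons_pair n) :> (set _ -> _) /\
    forall A : 'I_n.+1 -> set T, (forall i, measurable (A i)) ->
      (nu' (box A) = \prod_(i < n.+1) lebesgue_measure (A i))%E.
Proof.
exists nu; split => // A mA.
by rewrite [LHS]nu_box// mu_box// big_ord_recl.
Qed.

End step.

Let lebesgue_tuple_spec n :
  exists mu : {sigma_finite_measure set (n.-tuple T) -> \bar R},
    mu = lebesgue_tuple n :> (set _ -> _) /\
    forall A : 'I_n -> set T, (forall i, measurable (A i)) ->
      (mu (box A) = \prod_(i < n) lebesgue_measure (A i))%E.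
Proof.
elim: n => [|n [mu [muE mubox]]].
  exists (@dirac _ (0.-tuple T) [tuple] R); split => // A _.
  by rewrite big_ord0 /= diracE mem_set// => -[].
have [nu [nuE nubox]] := lebesgue_tuple_step mubox.
by exists nu; split; rewrite // nuE /= muE.
Qed.

Lemma lebesgue_tuple_box n (A : 'I_n -> set T) : (forall i, measurable (A i)) ->
  (lebesgue_tuple n (box A) = \prod_(i < n) lebesgue_measure (A i))%E.
Proof. by have [mu [<-]] := lebesgue_tuple_spec n; exact. Qed.

Section instance.
Variable n : nat.

Let lebesgue_tuple0 : lebesgue_tuple n set0 = 0%E.
Proof. by have [mu [<- _]] := lebesgue_tuple_spec n; rewrite measure0. Qed.

Let lebesgue_tuple_ge0 A : (0 <= lebesgue_tuple n A)%E.
Proof. by have [mu [<- _]] := lebesgue_tuple_spec n; exact: measure_ge0. Qed.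

Let lebesgue_tuple_additive : semi_sigma_additive (lebesgue_tuple n).
Proof.
by have [mu [<- _]] := lebesgue_tuple_spec n; exact: measure_semi_sigma_additive.
Qed.

HB.instance Definition _ := isMeasure.Build _ _ _ (lebesgue_tuple n)
  lebesgue_tuple0 lebesgue_tuple_ge0 lebesgue_tuple_additive.

Let lebesgue_tuple_sigma_finite : sigma_finite setT (lebesgue_tuple n).
Proof. by have [mu [<- _]] := lebesgue_tuple_spec n; exact: sigma_finiteT. Qed.

HB.instance Definition _ := Measure_isSigmaFinite.Build _ _ _
  (lebesgue_tuple n) lebesgue_tuple_sigma_finite.
End instance.

End lebesgue_tuple.
Arguments lebesgue_tuple {R} n A.

Section game.
Context {R : realType}.
Local Notation T := (measurableTypeR R).

Definition unit_cube (m : nat) : set (m.-tuple T) :=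
  box (fun _ : 'I_m => `[0, 1]%classic).
Arguments unit_cube m x : clear implicits.

Definition drop_coord n (i : 'I_n) (x : n.-tuple T) : n.-1.-tuple T :=
  [tuple tnth x (lift i j) | j < n.-1].

(* Takes the values 0 and 1: the parity of the floor of x. *)
Definition parity_floor (x : R) : int := Num.floor x - 2 * Num.floor (x / 2).

(* Only the values on the cube matter; outside it f is unconstrained. *)
Definition imaginary_strategy (m : nat) (f : m.-tuple T -> R) : Prop :=
  measurable_fun (unit_cube m) f /\ forall x, unit_cube m x -> 0 <= f x.

Definition payoff n (f : 'I_n -> n.-1.-tuple T -> R) : \bar R :=
  (\int[lebesgue_tuple n]_(x in unit_cube n)
     (\prod_(i < n)
        (parity_floor (f i (drop_coord i x) * tnth x i))%:~R)%:E)%E.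

Definition W (n : nat) : \bar R :=
  ereal_sup [set payoff f | f in
    [set f : 'I_n -> n.-1.-tuple T -> R | forall i, imaginary_strategy (f i)]].

End game.
Arguments unit_cube {R} m x.
Arguments W R n : clear implicits.

(* Main.v *)
Require Import Defs.
From mathcomp Require Import all_boot all_order all_algebra.
From mathcomp Require Import all_classical all_reals all_analysis.
From mathcomp Require Import measurable_realfun measurable_fun_approximation.
From mathcomp Require Import ring lra zify.

Import Order.TTheory GRing.Theory Num.Theory.

(** Write eps for the parity of the floor. For a fixed frequency c > 0 the set
    of the x in [0, 1] with eps (c * x) = 1 is a comb of teeth of length 1 / c
    with gaps of the same length, starting with a gap. Translation by 1 / c
    exchanges teeth and gaps, because eps (y + 1) = 1 - eps y. Moving the teeth
    to the left puts them inside the gaps, so the teeth have measure at most 1/2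
    ([odd_comb_le_half]); moving the gaps to the right puts them inside the
    teeth up to an overshoot of length 1 / c beyond 1, so the teeth have measure
    at least (1 - 1 / c) / 2 ([odd_comb_ge]).

    Upper bound. The payoff is at most the integral of its first factor. When
    all coordinates but the first are fixed, that factor is the indicator of a
    comb, whose frequency is the value of the first strategy; by Tonelli the
    payoff is at most 1/2 ([payoff_le_half]).

    Lower bound. The players can make their factors coincide: if player i plays
    N times the product of the other coordinates, then every factor is
    eps (N * x_1 * ... * x_n), and a product of equal 0-1 values is that value.
    The payoff is thus again an average of comb measures, now with frequencies
    N * x_2 * ... * x_n. Where x_2, ..., x_n are at least d, the choice
    N = d ^- n makes these frequencies at least 1 / d, hence the payoff is at
    least (1 - d) / 2 * (1 - d) ^ (n - 1) ([value_ge]), which tends to 1/2 as d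
    tends to 0. *)

Local Open Scope classical_set_scope.
Local Open Scope ring_scope.

(** * The parity of the floor *)

Section parity.
Context {R : realType}.
Implicit Types x c : R.

Lemma floor_parityE x :
  exists q : int, Num.floor x = 2 * q + parity_floor x /\
    (parity_floor x == 0) || (parity_floor x == 1).
Proof.
exists (Num.floor (x / 2)).
rewrite /parity_floor.
set q := Num.floor (x / 2); set m := Num.floor x.
have /andP[q1 q2] := floor_itv (x / 2).
have qm : (2 * q <= m)%R.
  by rewrite floor_ge_int intrM; rewrite -/q in q1 q2; lra.
have mq : (m < 2 * (q + 1))%R.
  by rewrite floor_lt_int intrM; rewrite -/q in q1 q2; lra.
by split; lia.
Qed.

Lemma parity_floor_bool x : (parity_floor x == 0) || (parity_floor x == 1).
Proof. by have [q []] := floor_parityE x. Qed.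

Lemma parity_floorD1 x : parity_floor (x + 1) = 1 - parity_floor x.
Proof.
have [q [qE]] := floor_parityE x.
have [r [rE]] := floor_parityE (x + 1).
have : Num.floor (x + 1) = Num.floor x + 1 by rewrite floorDrz// floor1.
lia.
Qed.

Lemma parity_floor_lt1 x : 0 <= x < 1 -> parity_floor x = 0.
Proof.
move=> /andP[x0 x1]; have [q [qE pE]] := floor_parityE x.
have : Num.floor x = 0 by apply: floor_def; rewrite x0 add0r.
lia.
Qed.

(** The two floors in the definition of the parity are monotone functions. *)
Lemma measurable_parity_floor :
  measurable_fun setT (fun x => (parity_floor x)%:~R : R).
Proof.
have mfloor (k : R) : 0 <= k ->
    measurable_fun setT (fun x : R => (Num.floor (x * k))%:~R : R).
  move=> k0; apply: nondecreasing_measurable => // x y xy.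
  by rewrite ler_int le_floor// ler_wpM2r.
rewrite (_ : (fun x => _) = (fun x : R => (Num.floor (x * 1))%:~R -
    2 * (Num.floor (x * 2^-1))%:~R)).
  apply: measurable_funB; first exact: mfloor.
  by apply: measurable_funM => //; apply: mfloor; rewrite invr_ge0.
by apply/funext => x; rewrite /parity_floor mulr1 intrB intrM.
Qed.

End parity.

(** * Combs in the unit interval *)

Section comb.
Context {R : realType}.
Local Notation T := (measurableTypeR R).
Local Notation mu := (@lebesgue_measure R).

(** Both sides are measures in A and agree on the intervals `]b, c], which
    determine Lebesgue measure. *)
Lemma lebesgue_measure_translate (a : R) (A : set T) : measurable A ->
  mu ((fun x => x + a) @^-1` A) = mu A.
Proof.
move=> mA.
have mT : measurable_fun setT ((fun x => x + a) : T -> T).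
  exact: measurable_funD.
apply/esym.
rewrite -[RHS]/(pushforward mu ((fun x => x + a) : T -> T) A).
apply: lebesgue_measure_unique => //= _ [[b c]] _ <-.
rewrite /pushforward (_ : _ @^-1` _ = [set` `]b - a, c - a]]).
  by rewrite !lebesgue_measure_itv/= !lte_fin ltrBlDr subrK; case: ifP => // _;
    rewrite -!EFinB; congr _%:E; ring.
by apply/seteqP; split => x /=; rewrite !in_itv/= ltrBlDr lerBrDr.
Qed.

Definition parity_comb (k : int) (c : R) : set T :=
  `[0, 1] `&` [set x | parity_floor (c * x) = k].

Lemma measurable_parity_comb k c : measurable (parity_comb k c).
Proof.
have mf : measurable_fun setT (fun x : T => (parity_floor (c * x))%:~R : R).
  apply: (@measurableT_comp _ _ _ _ _ _
    (fun x : R => (parity_floor x)%:~R : R)).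
    exact: measurable_parity_floor.
  exact: measurable_funM.
rewrite (_ : parity_comb k c = `[0, 1] `&`
  (setT `&` (fun x => (parity_floor (c * x))%:~R) @^-1` [set k%:~R : R])).
  by apply: measurableI => //; exact: mf.
rewrite setTI; congr (_ `&` _).
by apply/seteqP; split => x /= => [->//|/intr_inj].
Qed.

Lemma parity_comb_split c :
  exists a b : R, [/\ mu (parity_comb 0 c) = a%:E, mu (parity_comb 1 c) = b%:E
    & a + b = 1].
Proof.
have m0 := measurable_parity_comb 0 c; have m1 := measurable_parity_comb 1 c.
have mI : mu `[0, 1] = 1%E by rewrite lebesgue_measure_itv/= lte01 oppr0 adde0.
have E : (mu (parity_comb 0 c) + mu (parity_comb 1 c) = 1)%E.
  rewrite -mI -measureU//.
    congr (mu _); apply/seteqP; split => x; first by case; case.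
    by move=> Ix; case/orP: (parity_floor_bool (c * x)) => /eqP; [left|right].
  by apply/seteqP; split => x // [[_ /= p0] [_ /=]]; rewrite p0.
have f k : mu (parity_comb k c) \is a fin_num.
  rewrite ge0_fin_numE//; apply: (@le_lt_trans _ _ 1%E); last exact: ltry.
  by rewrite -mI; apply: le_measure; rewrite ?inE//;
    [exact: measurable_parity_comb|move=> x []].
exists (fine (mu (parity_comb 0 c))), (fine (mu (parity_comb 1 c))).
by rewrite !fineK//; split => //; apply: EFin_inj; rewrite EFinD !fineK.
Qed.

(** Each tooth is preceded by a gap of the same length, so translation by
    - 1 / c maps the teeth into the gaps. *)
Lemma odd_comb_le_half c : 0 <= c -> (mu (parity_comb 1 c) <= (2^-1 : R)%:E)%E.
Proof.
rewrite le_eqVlt => /predU1P[<-|c0].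
  rewrite (_ : parity_comb 1 0 = set0) ?measure0//.
  apply/seteqP; split => // x [_ /=].
  by rewrite mul0r parity_floor_lt1// lexx ltr01.
have [a [b [aE bE ab]]] := parity_comb_split c.
suff : (mu (parity_comb 1 c) <= mu (parity_comb 0 c))%E.
  by rewrite aE bE !lee_fin; lra.
have m0 := measurable_parity_comb 0 c; have m1 := measurable_parity_comb 1 c.
rewrite -(lebesgue_measure_translate (- c^-1) _ m0).
apply: le_measure; rewrite ?inE//.
  rewrite -[X in measurable X]setTI.
  have mT : measurable_fun setT ((fun x => x - c^-1) : T -> T).
    exact: measurable_funB.
  exact: mT.
move=> x [] /=; rewrite in_itv/= => /andP[x0 x1] px.
(* An odd floor is at least 1, so x - 1 / c stays in [0, 1]. *)
have cx1 : 1 <= c * x.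
  rewrite leNgt; apply/negP => cx1.
  by rewrite parity_floor_lt1// in px; rewrite cx1 mulr_ge0// ltW.
split => /=.
  rewrite in_itv/= subr_ge0 -(ler_pM2l c0) divff ?gt_eqF// cx1/=.
  by rewrite lerBlDr (le_trans x1)// lerDl invr_ge0 ltW.
have /esym := parity_floorD1 (c * (x - c^-1)).
by rewrite mulrBr divff ?gt_eqF// subrK px; lia.
Qed.

(** Each gap is followed by a tooth of the same length, which the end of the
    unit interval may cut off: translation by 1 / c maps the gaps into the
    union of the teeth and `]1, 1 + 1 / c]. *)
Lemma odd_comb_ge c : 0 < c ->
  ((2^-1 * (1 - c^-1))%:E <= mu (parity_comb 1 c))%E.
Proof.
move=> c0.
have [a [b [aE bE ab]]] := parity_comb_split c.
suff : (mu (parity_comb 0 c) <= mu (parity_comb 1 c) + (c^-1)%:E)%E.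
  by rewrite aE bE -EFinD !lee_fin; lra.
have m0 := measurable_parity_comb 0 c; have m1 := measurable_parity_comb 1 c.
have -> : (c^-1)%:E = mu `]1, 1 + c^-1].
  by rewrite lebesgue_measure_itv/= lte_fin ltrDl invr_gt0 c0 -EFinB
    addrAC subrr add0r.
have mJ : measurable (`]1, 1 + c^-1] : set T) by [].
have tr := lebesgue_measure_translate c^-1 _ (measurableU _ _ m1 mJ).
suff : (mu (parity_comb 0 c) <=
    mu ((fun x => (x + c^-1)%R) @^-1`
      (parity_comb 1 c `|` `]1%R, (1 + c^-1)%R])))%E.
  by rewrite tr => /le_trans; apply; exact: measureU2.
apply: le_measure; rewrite ?inE//.
  rewrite -[X in measurable X]setTI.
  have mT : measurable_fun setT ((fun x => x + c^-1) : T -> T).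
    exact: measurable_funD.
  by apply: mT => //; exact: measurableU.
move=> x [] /=; rewrite in_itv/= => /andP[x0 x1] px.
have [xc|xc] := leP (x + c^-1) 1; [left|right]; last first.
  by rewrite /= in_itv/= xc lerD2r.
split => /=; first by rewrite in_itv/= xc addr_ge0// invr_ge0 ltW.
by rewrite mulrDr divff ?gt_eqF// parity_floorD1 px.
Qed.

End comb.

(** * Slicing the cube along the first coordinate *)

Section slicing.
Context {R : realType}.
Local Notation T := (measurableTypeR R).
Local Notation mu := (@lebesgue_measure R).

(** Tonelli for sets. The measure \x integrates over its first factor; by
    uniqueness of the product measure the order can be reversed, so that the
    sections run along the first coordinate. *)
Lemma lebesgue_tupleS n (A : set (n.+1.-tuple T)) : measurable A ->
  measurable_fun setT (fun t => mu [set a | A (cons_pair (a, t))]) /\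
  lebesgue_tuple n.+1 A =
    (\int[lebesgue_tuple n]_t mu [set a | A (cons_pair (a, t))])%E.
Proof.
move=> mA.
have mX : measurable (@cons_pair R n @^-1` A).
  by rewrite -[X in measurable X]setTI; exact: measurable_cons_pair.
have secE t : [set a | A (cons_pair (a, t))] =
    ysection (@cons_pair R n @^-1` A) t.
  by apply/seteqP; split => a; rewrite /ysection/= inE.
split; first by under eq_fun do rewrite secE; exact: measurable_fun_ysection.
transitivity ((mu \x lebesgue_tuple n)%E (@cons_pair R n @^-1` A)) => //.
rewrite (product_measure_unique (m' := (mu \x^ lebesgue_tuple n)%E))//.
  by apply: eq_integral => t _ /=; rewrite secE.
by move=> B C mB mC; exact: product_measure2E.
Qed.

Lemma measurable_unit_cube n : measurable (unit_cube n : set (n.-tuple T)).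
Proof. exact: measurable_box. Qed.

Lemma lebesgue_tuple_cube n (a : R) : 0 <= a <= 1 ->
  lebesgue_tuple n (box (fun=> `[a, 1]%classic : set T)) = ((1 - a) ^+ n)%:E.
Proof.
move=> /andP[a0 a1]; rewrite lebesgue_tuple_box//.
under eq_bigr do rewrite lebesgue_measure_itv/= lte_fin.
have [_|] := ltP a 1.
  by rewrite -EFinB prodEFin prodr_const card_ord.
by move=> a1'; have -> : a = 1 by [lra]; rewrite subrr; case: n => [|n];
  rewrite ?big_ord0// big_ord_recl mul0e expr0n.
Qed.

Lemma drop_coord_cube n (i : 'I_n) (x : n.-tuple T) :
  unit_cube n x -> unit_cube n.-1 (drop_coord i x).
Proof. by move=> cx j; rewrite tnth_mktuple; exact: cx. Qed.

Lemma measurable_drop_coord n (i : 'I_n) :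
  measurable_fun setT (@drop_coord R n i).
Proof.
apply/measurable_fun_tnthP => j.
rewrite (_ : _ \o _ = @tnth n T ^~ (lift i j)); first exact: measurable_tnth.
by apply/funext => x /=; rewrite tnth_mktuple.
Qed.

Lemma measurable_payoff_factor n (i : 'I_n) (f : n.-1.-tuple T -> R) :
  measurable_fun (unit_cube n.-1) f ->
  measurable_fun (unit_cube n : set (n.-tuple T))
    (fun x => (parity_floor (f (drop_coord i x) * tnth x i))%:~R : R).
Proof.
move=> mf.
apply: (@measurableT_comp _ _ _ _ _ _ (fun x : R => (parity_floor x)%:~R : R)).
  exact: measurable_parity_floor.
apply: measurable_funM; last by apply: measurable_funTS; exact: measurable_tnth.
apply: (measurable_comp (measurable_unit_cube n.-1)) => //.
  by move=> _ [x cx <-]; exact: drop_coord_cube.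
by apply: measurable_funTS; exact: measurable_drop_coord.
Qed.

(** The support in the cube of the factor that player i contributes to the
    payoff. *)
Definition win_set n (i : 'I_n) (f : n.-1.-tuple T -> R) : set (n.-tuple T) :=
  unit_cube n `&` [set x | parity_floor (f (drop_coord i x) * tnth x i) = 1].

Arguments win_set {n} i f.

Lemma measurable_win_set n (i : 'I_n) (f : n.-1.-tuple T -> R) :
  measurable_fun (unit_cube n.-1) f -> measurable (win_set i f).
Proof.
move=> mf.
have := measurable_payoff_factor _ i _ mf
  (measurable_unit_cube n) [set 1] (measurable_set1 _).
congr measurable; congr (_ `&` _).
by apply/seteqP; split => x /=;
  [move/eqP; rewrite -[1]/(1%:~R) eqr_int => /eqP|move->].
Qed.

Lemma payoff_factorE n (i : 'I_n) (f : n.-1.-tuple T -> R) x :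
  unit_cube n x ->
  (parity_floor (f (drop_coord i x) * tnth x i))%:~R = \1_(win_set i f) x :> R.
Proof.
move=> cx; rewrite indicE.
have [|] := boolP (x \in win_set i f); first by rewrite inE => -[_ /= ->].
case/orP: (parity_floor_bool (f (drop_coord i x) * tnth x i)) => /eqP p;
  first by rewrite p.
by rewrite notin_setE => -[].
Qed.

Lemma win_set_section n (f : n.-tuple T -> R) (t : n.-tuple T) :
  unit_cube n t ->
  [set a | win_set (ord0 : 'I_n.+1) f (cons_pair (a, t))] = parity_comb 1 (f t).
Proof.
move=> ct.
have dE a : drop_coord ord0 (cons_pair (a, t)) = t.
  by apply: eq_from_tnth => j; rewrite tnth_mktuple tnthS.
apply/seteqP; split=> a.
  move=> [/(_ ord0) /= ca]; rewrite /= dE => pa.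
  by split; [exact: ca|rewrite /= -pa].
move=> [Ia pa]; split; last by rewrite /= dE.
move=> i; case: (unliftP ord0 i) => [j ->|->]; last exact: Ia.
by rewrite tnthS; exact: ct.
Qed.

Lemma win_set_section_out n (f : n.-tuple T -> R) (t : n.-tuple T) :
  ~ unit_cube n t ->
  [set a | win_set (ord0 : 'I_n.+1) f (cons_pair (a, t))] = set0.
Proof.
move=> nct; apply/seteqP; split=> // a [c _]; apply: nct => j.
by have := c (lift ord0 j); rewrite tnthS.
Qed.

Lemma win_set_le_half n (f : n.-tuple T -> R) :
  imaginary_strategy f ->
  (lebesgue_tuple n.+1 (win_set (ord0 : 'I_n.+1) f) <= (2^-1 : R)%:E)%E.
Proof.
move=> [mf f0].
have [mS ->] := lebesgue_tupleS _ _
  (measurable_win_set _ (ord0 : 'I_n.+1) _ mf).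
set S := fun t => _ in mS *.
have -> : (\int[lebesgue_tuple n]_t S t =
    \int[lebesgue_tuple n]_(t in unit_cube n) S t)%E.
  rewrite [RHS]integral_mkcond; apply: eq_integral => t _.
  rewrite patchE; case: ifPn => //; rewrite notin_setE => nct.
  by rewrite /S win_set_section_out// measure0.
apply: (@le_trans _ _ (\int[lebesgue_tuple n]_(t in unit_cube n)
    (cst (2^-1 : R)%:E t))%E).
  apply: ge0_le_integral => //.
  - exact: measurable_unit_cube.
  - exact: measurable_funTS.
  - by move=> t ct; rewrite /S win_set_section// odd_comb_le_half// f0.
rewrite integral_cst; last exact: measurable_unit_cube.
rewrite [X in (_ * X)%E](lebesgue_tuple_cube n 0) ?lexx ?ler01//.
by rewrite subr0 expr1n mule1.
Qed.

(** Sections over [d, 1] ^ n are combs of frequency at least c; the other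
    sections are discarded. *)
Lemma win_set_ge n (f : n.-tuple T -> R) (d c : R) :
  imaginary_strategy f -> 0 <= d <= 1 -> 0 < c ->
  (forall t, box (fun=> `[d, 1]%classic : set T) t -> c <= f t) ->
  ((2^-1 * (1 - c^-1) * (1 - d) ^+ n)%:E <=
    lebesgue_tuple n.+1 (win_set (ord0 : 'I_n.+1) f))%E.
Proof.
move=> [mf f0] d01 c0 cf.
have [mS ->] := lebesgue_tupleS _ _
  (measurable_win_set _ (ord0 : 'I_n.+1) _ mf).
set S := fun t => _ in mS *.
pose B : set (n.-tuple T) := box (fun=> `[d, 1]%classic).
have mB : measurable B by exact: measurable_box.
apply: (@le_trans _ _ (\int[lebesgue_tuple n]_(t in B) S t)%E); last first.
  exact: ge0_subset_integral.
(* For c <= 1 the left-hand side is not positive. *)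
have [c1|c1] := leP c 1.
  apply: (@le_trans _ _ 0%E); last exact: integral_ge0.
  rewrite lee_fin mulr_le0_ge0//.
    by rewrite pmulr_rle0 ?invr_gt0// subr_le0 invf_ge1.
  by rewrite exprn_ge0// subr_ge0; case/andP: d01.
apply: (@le_trans _ _ (\int[lebesgue_tuple n]_(t in B)
    (cst (2^-1 * (1 - c^-1))%:E t))%E).
  by rewrite integral_cst// [X in (_ * X)%E](lebesgue_tuple_cube n d).
apply: ge0_le_integral => //.
- move=> t _; rewrite lee_fin mulr_ge0 ?invr_ge0// subr_ge0 invf_le1//.
  exact: ltW.
- exact: measurable_funTS.
move=> t Bt; rewrite /S win_set_section; last first.
  move=> i; have := Bt i; rewrite /= !in_itv/= => /andP[di ->].
  by rewrite andbT (le_trans _ di)//; case/andP: d01.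
have cft := cf t Bt; have ft0 := lt_le_trans c0 cft.
apply: le_trans (odd_comb_ge _ ft0).
by rewrite lee_fin ler_wpM2l ?invr_ge0// lerD2l lerN2 lef_pV2.
Qed.

End slicing.
Arguments win_set {R n} i f.

(** * The value of the game *)

Section value.
Context {R : realType}.
Local Notation T := (measurableTypeR R).

Lemma payoff_le_half n (f : 'I_n.+1 -> n.-tuple T -> R) :
  (forall i, imaginary_strategy (f i)) ->
  (payoff (f : 'I_n.+1 -> n.+1.-1.-tuple T -> R) <= (2^-1 : R)%:E)%E.
Proof.
move=> sf.
apply: le_trans (win_set_le_half _ _ (sf ord0)).
have mw := measurable_win_set _ (ord0 : 'I_n.+1) _ (proj1 (sf ord0)).
have wc : win_set ord0 (f ord0) `&` unit_cube n.+1 = win_set ord0 (f ord0).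
  by apply/setIidPl => x [].
rewrite -wc -integral_indic//; last exact: measurable_unit_cube.
have p01 i (x : n.+1.-tuple T) :
    0 <= ((parity_floor (f i (drop_coord i x) * tnth x i))%:~R : R) <= 1.
  by case/orP: (parity_floor_bool (f i (drop_coord i x) * tnth x i)) => /eqP ->;
    rewrite ?lexx ler01.
apply: ge0_le_integral => //.
- exact: measurable_unit_cube.
- by move=> x _; rewrite lee_fin prodr_ge0// => i _; case/andP: (p01 i x).
- apply/measurable_EFinP; apply: measurable_prod => i _.
  by apply: measurable_payoff_factor; case: (sf i).
- by apply/measurable_EFinP; exact: measurable_indic.
move=> x cx; rewrite lee_fin -payoff_factorE// big_ord_recl.
rewrite ler_piMr//; first by case/andP: (p01 ord0 x).
by apply: prodr_ile1 => i _; exact: p01.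
Qed.

(** The cooperating strategy: multiplying it by the missing coordinate gives
    the same quantity for all players. *)
Definition product_strategy (n : nat) (N : R) (t : n.-tuple T) : R :=
  N * \prod_(j < n) tnth t j.

Lemma product_strategyP n (N : R) : 0 <= N ->
  imaginary_strategy (@product_strategy n N).
Proof.
move=> N0; split => [|t ct].
  apply: measurable_funM => //; apply: measurable_prod => j _.
  by apply: measurable_funTS; exact: measurable_tnth.
rewrite mulr_ge0// prodr_ge0// => j _.
by have := ct j; rewrite /= in_itv/= => /andP[].
Qed.

Lemma product_strategy_drop n (N : R) (i : 'I_n) (x : n.-tuple T) :
  product_strategy n.-1 N (drop_coord i x) * tnth x i =
  N * \prod_(j < n) tnth x j.
Proof.
rewrite /product_strategy [in RHS](@bigD1_ord _ _ _ _ i)//= -mulrA.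
rewrite [_ * tnth x i]mulrC.
by congr (_ * (_ * _)); apply: eq_bigr => j _; rewrite tnth_mktuple.
Qed.

Lemma payoff_product_strategy n (N : R) : 0 <= N ->
  payoff (fun _ : 'I_n.+1 => product_strategy n.+1.-1 N) =
  lebesgue_tuple n.+1 (win_set (ord0 : 'I_n.+1) (product_strategy n N)).
Proof.
move=> N0.
have wc : win_set ord0 (product_strategy n N) `&` unit_cube n.+1 =
    win_set ord0 (product_strategy n N).
  by apply/setIidPl => x [].
have [mf _] := product_strategyP n N N0.
rewrite -wc -integral_indic//; last 2 first.
- exact: measurable_unit_cube.
- exact: measurable_win_set.
apply: eq_integral => x; rewrite inE => cx; congr _%:E.
have dE (i : 'I_n.+1) : product_strategy n N (drop_coord i x) * tnth x i =
  N * \prod_(j < n.+1) tnth x j := product_strategy_drop n.+1 N i x.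
rewrite -payoff_factorE// dE.
under eq_bigr do rewrite dE.
(* Values in {0, 1} are equal to their powers of positive exponent. *)
rewrite prodr_const card_ord.
by case/orP: (parity_floor_bool (N * \prod_(j < n.+1) tnth x j)) => /eqP ->;
  rewrite ?expr0n ?expr1n.
Qed.

(** With N = d ^- n.+1 the combs over [d, 1] ^ n have frequency at least
    N * d ^ n = 1 / d, which contributes one factor 1 - d; the volume of
    [d, 1] ^ n contributes the other n. *)
Lemma value_ge n (d : R) : 0 < d < 1 ->
  ((2^-1 * (1 - d) ^+ n.+1)%:E <= W R n.+1)%E.
Proof.
move=> /andP[d0 d1].
pose N := d ^- n.+1.
have N0 : 0 <= N by rewrite invr_ge0 exprn_ge0// ltW.
apply: (@le_trans _ _ (payoff (fun _ : 'I_n.+1 => product_strategy n.+1.-1 N))).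
  rewrite payoff_product_strategy//.
  have := win_set_ge n (product_strategy n N) d d^-1 (product_strategyP _ _ N0).
  rewrite invrK exprS mulrA; apply; rewrite ?ltW ?invr_gt0// => t Bt.
  rewrite /product_strategy.
  have dn : d ^+ n <= \prod_(j < n) tnth t j.
    rewrite -[n in d ^+ n]card_ord -prodr_const; apply: ler_prod => j _.
    by have := Bt j; rewrite /= in_itv/= (ltW d0) => /andP[].
  have -> : d^-1 = N * d ^+ n.
    by rewrite /N exprSr invfM mulrAC mulVf ?mul1r// expf_neq0// gt_eqF.
  exact: ler_wpM2l.
apply: ereal_sup_ubound; exists (fun _ => product_strategy n.+1.-1 N) => // i.
exact: product_strategyP.
Qed.

Lemma bernoulli_sub n (d : R) : 0 <= d <= 1 -> 1 - d *+ n <= (1 - d) ^+ n.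
Proof.
move=> /andP[d0 d1]; elim: n => [|n IH]; first by rewrite mulr0n subr0.
apply: (@le_trans _ _ ((1 - d) * (1 - d *+ n))).
  have : 0 <= d * (d *+ n) by rewrite mulr_ge0// mulrn_wge0.
  by rewrite mulrS; lra.
by rewrite exprS ler_wpM2l// subr_ge0.
Qed.

End value.

Local Close Scope classical_set_scope.

Theorem theorem34 (R : realType) (n : nat) (hn : (2 <= n)%N) :
  W R n = (2^-1 : R)%:E.
Proof.
case: n hn => // n _; apply/le_anti/andP; split.
  by apply: ge_ereal_sup => _ [f sf <-]; exact: payoff_le_half.
apply/lee_addgt0Pr => e e0.
have n0 : 0 < n.+1%:R :> R by [].
(* This d satisfies both d < 1 and d * n.+1 <= e. *)
pose d := e / (n.+1%:R + e).
have ne0 : 0 < n.+1%:R + e by rewrite addr_gt0.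
have d01 : 0 < d < 1.
  by rewrite divr_gt0//= ltr_pdivrMr// mul1r ltrDr.
apply: (@le_trans _ _ ((2^-1 * (1 - d) ^+ n.+1)%:E + e%:E)%E); last first.
  by rewrite leeD2r// value_ge.
have dn : d *+ n.+1 <= e.
  rewrite -mulr_natr mulrAC ler_pdivrMr// ler_wpM2l ?ltW//.
  by rewrite ltrDl.
have := bernoulli_sub n.+1 d.
have /andP[/ltW -> /ltW ->] := d01 => /(_ isT) b.
by rewrite -EFinD lee_fin; lra.
Qed.
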